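(* When the connectives $\blacktriangle,\blacktriangledown,\vartriangle,\triangledown$ are identified with $F,G,P,H$, respectively, $\mathrm{IK}_t=\mathrm{Int2GC{+}FS}$; that is, exactly the same formulas are provable in intuitionistic tense logic $\mathrm{IK}_t$ and in Int2GC+FS.
   Context: Formulas are built from a countably infinite set $\mathrm{Var}$ of propositional variables with the connectives $\neg,\vee,\wedge,\to$ and four unary connectives $\blacktriangle,\blacktriangledown,\vartriangle,\triangledown$ (for Int2GC+FS), respectively $F,G,P,H$ (for $\mathrm{IK}_t$). The logic Int2GC is the smallest set of formulas (called provable formulas) that contains intuitionistic propositional logic (in this language) and is closed under substitution, modus ponens, and the four rules: from $A\to\triangledown B$ infer $\blacktriangle A\to B$; from $\blacktriangle A\to B$ infer $A\to\triangledown B$; from $A\to\blacktriangledown B$ infer $\vartriangle A\to B$; from $\vartriangle A\to B$ infer $A\to\blacktriangledown B$. The logic Int2GC+FS is the smallest set of formulas closed under the same rules that contains Int2GC and all instances of (FS1) $\blacktriangle(A\to B)\to(\blacktriangledown A\to\blacktriangle B)$, (FS2) $\vartriangle(A\to B)\to(\triangledown A\to\vartriangle B)$, (FS3) $(\blacktriangle A\to\blacktriangledown B)\to\blacktriangledown(A\to B)$, (FS4) $(\vartriangle A\to\triangledown B)\to\triangledown(A\to B)$. $\mathrm{IK}_t$ (Ewald) is the Hilbert-style system whose axioms are all axioms of intuitionistic logic together with all instances of the schemes (2) $G(A\to B)\to(GA\to GB)$; (2$'$) $H(A\to B)\to(HA\to HB)$; (3) $G(A\wedge B)\leftrightarrow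 GA\wedge GB$; (3$'$) $H(A\wedge B)\leftrightarrow HA\wedge HB$; (4) $F(A\vee B)\leftrightarrow FA\vee FB$; (4$'$) $P(A\vee B)\leftrightarrow PA\vee PB$; (5) $G(A\to B)\to(FA\to FB)$; (5$'$) $H(A\to B)\to(PA\to PB)$; (6) $GA\wedge FB\to F(A\wedge B)$; (6$'$) $HA\wedge PB\to P(A\wedge B)$; (7) $G\neg A\to\neg FA$; (7$'$) $H\neg A\to\neg PA$; (8) $FHA\to A$; (8$'$) $PGA\to A$; (9) $A\to HFA$; (9$'$) $A\to GPA$; (10) $(FA\to GB)\to G(A\to B)$; (10$'$) $(PA\to HB)\to H(A\to B)$; (11) $F(A\to B)\to(GA\to FB)$; (11$'$) $P(A\to B)\to(HA\to PB)$; and whose rules are modus ponens, (RH) from $A$ infer $HA$, and (RG) from $A$ infer $GA$. *)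

(* Defs.v *)
(** [F], [G], [P], [H] are the four tense connectives.  The Galois-connection
    connectives are identified with them by parsing-only notations:
    ▲ = F, ▼ = G, △ = P, ▽ = H. *)
Inductive form : Type :=
| Var (n : nat)
| Neg (A : form)
| Or (A B : form)
| And (A B : form)
| Imp (A B : form)
| F (A : form)
| G (A : form)
| P (A : form)
| H (A : form).

Declare Scope form_scope.
Delimit Scope form_scope with form.
Bind Scope form_scope with form.

Notation "¬ A" := (Neg A) (at level 35, right associativity) : form_scope.
Notation "A ∧ B" := (And A B) (at level 40, left associativity) : form_scope.
Notation "A ∨ B" := (Or A B) (at level 50, left associativity) : form_scope.
Notation "A → B" := (Imp A B) (at level 60, right associativity) : form_scope.
Notation "A ↔ B" := (And (Imp A B) (Imp B A)) (at level 65, no associativity)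
  : form_scope.
Notation "▲ A" := (F A) (at level 35, right associativity, only parsing)
  : form_scope.
Notation "▼ A" := (G A) (at level 35, right associativity, only parsing)
  : form_scope.
Notation "△ A" := (P A) (at level 35, right associativity, only parsing)
  : form_scope.
Notation "▽ A" := (H A) (at level 35, right associativity, only parsing)
  : form_scope.

Local Open Scope form_scope.

Fixpoint subst (s : nat -> form) (A : form) : form :=
  match A with
  | Var n => s n
  | ¬ A => ¬ subst s A
  | A ∨ B => subst s A ∨ subst s B
  | A ∧ B => subst s A ∧ subst s B
  | A → B => subst s A → subst s B
  | F A => F (subst s A)
  | G A => G (subst s A)
  | P A => P (subst s A)
  | H A => H (subst s A)
  end.

(** A standard Hilbert axiomatization of intuitionistic propositional logic with
    primitive negation; [A], [B], [C] range over all of [form]. *)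
Inductive ipl_axiom : form -> Prop :=
| ipl_K A B : ipl_axiom (A → B → A)
| ipl_S A B C : ipl_axiom ((A → B → C) → (A → B) → A → C)
| ipl_andE1 A B : ipl_axiom (A ∧ B → A)
| ipl_andE2 A B : ipl_axiom (A ∧ B → B)
| ipl_andI A B : ipl_axiom (A → B → A ∧ B)
| ipl_orI1 A B : ipl_axiom (A → A ∨ B)
| ipl_orI2 A B : ipl_axiom (B → A ∨ B)
| ipl_orE A B C : ipl_axiom ((A → C) → (B → C) → A ∨ B → C)
| ipl_negI A B : ipl_axiom ((A → B) → (A → ¬ B) → ¬ A)
| ipl_negE A B : ipl_axiom (¬ A → A → B).

Inductive IPL : form -> Prop :=
| IPL_ax A : ipl_axiom A -> IPL A
| IPL_mp A B : IPL (A → B) -> IPL A -> IPL B.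

Inductive Int2GC : form -> Prop :=
| Int2GC_IPL A : IPL A -> Int2GC A
| Int2GC_subst s A : Int2GC A -> Int2GC (subst s A)
| Int2GC_mp A B : Int2GC (A → B) -> Int2GC A -> Int2GC B
| Int2GC_gc1 A B : Int2GC (A → ▽ B) -> Int2GC (▲ A → B)
| Int2GC_gc2 A B : Int2GC (▲ A → B) -> Int2GC (A → ▽ B)
| Int2GC_gc3 A B : Int2GC (A → ▼ B) -> Int2GC (△ A → B)
| Int2GC_gc4 A B : Int2GC (△ A → B) -> Int2GC (A → ▼ B).

Inductive FS_axiom : form -> Prop :=
| FS1 A B : FS_axiom (▲ (A → B) → (▼ A → ▲ B))
| FS2 A B : FS_axiom (△ (A → B) → (▽ A → △ B))
| FS3 A B : FS_axiom ((▲ A → ▼ B) → ▼ (A → B))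
| FS4 A B : FS_axiom ((△ A → ▽ B) → ▽ (A → B)).

Inductive Int2GC_FS : form -> Prop :=
| FS_Int2GC A : Int2GC A -> Int2GC_FS A
| FS_ax A : FS_axiom A -> Int2GC_FS A
| FS_subst s A : Int2GC_FS A -> Int2GC_FS (subst s A)
| FS_mp A B : Int2GC_FS (A → B) -> Int2GC_FS A -> Int2GC_FS B
| FS_gc1 A B : Int2GC_FS (A → ▽ B) -> Int2GC_FS (▲ A → B)
| FS_gc2 A B : Int2GC_FS (▲ A → B) -> Int2GC_FS (A → ▽ B)
| FS_gc3 A B : Int2GC_FS (A → ▼ B) -> Int2GC_FS (△ A → B)
| FS_gc4 A B : Int2GC_FS (△ A → B) -> Int2GC_FS (A → ▼ B).

Inductive IKt_axiom : form -> Prop :=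
| IKt2 A B : IKt_axiom (G (A → B) → (G A → G B))
| IKt2' A B : IKt_axiom (H (A → B) → (H A → H B))
| IKt3 A B : IKt_axiom (G (A ∧ B) ↔ G A ∧ G B)
| IKt3' A B : IKt_axiom (H (A ∧ B) ↔ H A ∧ H B)
| IKt4 A B : IKt_axiom (F (A ∨ B) ↔ F A ∨ F B)
| IKt4' A B : IKt_axiom (P (A ∨ B) ↔ P A ∨ P B)
| IKt5 A B : IKt_axiom (G (A → B) → (F A → F B))
| IKt5' A B : IKt_axiom (H (A → B) → (P A → P B))
| IKt6 A B : IKt_axiom (G A ∧ F B → F (A ∧ B))
| IKt6' A B : IKt_axiom (H A ∧ P B → P (A ∧ B))
| IKt7 A : IKt_axiom (G (¬ A) → ¬ F A)
| IKt7' A : IKt_axiom (H (¬ A) → ¬ P A)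
| IKt8 A : IKt_axiom (F (H A) → A)
| IKt8' A : IKt_axiom (P (G A) → A)
| IKt9 A : IKt_axiom (A → H (F A))
| IKt9' A : IKt_axiom (A → G (P A))
| IKt10 A B : IKt_axiom ((F A → G B) → G (A → B))
| IKt10' A B : IKt_axiom ((P A → H B) → H (A → B))
| IKt11 A B : IKt_axiom (F (A → B) → (G A → F B))
| IKt11' A B : IKt_axiom (P (A → B) → (H A → P B)).

Inductive IKt : form -> Prop :=
| IKt_ipl A : ipl_axiom A -> IKt A
| IKt_ax A : IKt_axiom A -> IKt A
| IKt_mp A B : IKt (A → B) -> IKt A -> IKt B
| IKt_RH A : IKt A -> IKt (H A)
| IKt_RG A : IKt A -> IKt (G A).

(* Main.v *)
(** In [IKt], (5) and (8) give the rule from [A → H B] to [F A → B], and (2')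
    and (9) the converse; (10) and (11) are (FS3) and (FS1).  In [Int2GC_FS],
    [F] and [P] are left adjoints of [H] and [G], so all four connectives are
    monotone, [F] preserves joins and [G] preserves meets.  (5) and (6) follow
    from (FS1) applied to the monotone images under [F] of [A → (A → B) → B]
    and [B → A → A ∧ B], and (7) from (6) since [F] preserves falsity.  Both
    calculi are invariant under exchanging [F] with [P] and [G] with [H]; this
    yields the primed axioms. *)

Require Import Defs.

Local Open Scope form_scope.

(** * Derived rules of intuitionistic propositional logic, shared by both calculi *)

Record ipl_theory (T : form -> Prop) : Prop := {
  theory_ax : forall A, ipl_axiom A -> T A;
  theory_mp : forall A B, T (A → B) -> T A -> T B
}.

Arguments theory_ax {T} _ {A} _.
Arguments theory_mp {T} _ {A B} _ _.

Section IntuitionisticTheory.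

Context {T : form -> Prop} (thT : ipl_theory T).

Lemma theory_IPL A : IPL A -> T A.
Proof.
  induction 1 as [A a|A B _ tAB _ tA].
  - exact (theory_ax thT a).
  - exact (theory_mp thT tAB tA).
Qed.

Lemma imp_const {A B} : T B -> T (A → B).
Proof. exact (theory_mp thT (theory_ax thT (ipl_K B A))). Qed.

Lemma imp_app {A B C} : T (A → B → C) -> T (A → B) -> T (A → C).
Proof.
  intros tABC.
  exact (theory_mp thT (theory_mp thT (theory_ax thT (ipl_S A B C)) tABC)).
Qed.

Lemma imp_trans {A B C} : T (A → B) -> T (B → C) -> T (A → C).
Proof. intros tAB tBC. exact (imp_app (imp_const tBC) tAB). Qed.

Lemma imp_refl A : T (A → A).
Proof.
  exact (imp_app (theory_ax thT (ipl_K A (A → A))) (theory_ax thT (ipl_K A A))).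
Qed.

Lemma imp_flip {A B C} : T (A → B → C) -> T (B → A → C).
Proof.
  intros tABC. apply (imp_trans (theory_ax thT (ipl_K B A))).
  exact (theory_mp thT (theory_ax thT (ipl_S A B C)) tABC).
Qed.

Lemma imp_and {A B C} : T (C → A) -> T (C → B) -> T (C → A ∧ B).
Proof.
  intros tCA tCB.
  exact (imp_app (imp_trans tCA (theory_ax thT (ipl_andI A B))) tCB).
Qed.

Lemma and_imp {A B C} : T (A → B → C) -> T (A ∧ B → C).
Proof.
  intros tABC. apply (@imp_app _ B).
  - exact (imp_trans (theory_ax thT (ipl_andE1 A B)) tABC).
  - apply (theory_ax thT), ipl_andE2.
Qed.

Lemma imp_curry {A B C} : T (A ∧ B → C) -> T (A → B → C).
Proof.
  intros tABC. apply (imp_trans (theory_ax thT (ipl_andI A B))).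
  exact (theory_mp thT (theory_ax thT (ipl_S B (A ∧ B) C)) (imp_const tABC)).
Qed.

Lemma or_imp {A B C} : T (A → C) -> T (B → C) -> T (A ∨ B → C).
Proof.
  intros tAC.
  exact (theory_mp thT (theory_mp thT (theory_ax thT (ipl_orE A B C)) tAC)).
Qed.

Lemma iff_intro {A B} : T (A → B) -> T (B → A) -> T (A ↔ B).
Proof.
  intros tAB. exact (theory_mp thT (theory_mp thT (theory_ax thT (ipl_andI _ _)) tAB)).
Qed.

End IntuitionisticTheory.

(** * From [Int2GC_FS] to [IKt] *)

Lemma ipl_axiom_subst s A : ipl_axiom A -> ipl_axiom (subst s A).
Proof. intros []; constructor. Qed.

Lemma IKt_axiom_subst s A : IKt_axiom A -> IKt_axiom (subst s A).
Proof. intros []; constructor. Qed.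

(** Substitution is not a rule of [IKt] but is admissible: every axiom is a scheme, and the rules
    commute with [subst]. *)
Lemma IKt_subst s A : IKt A -> IKt (subst s A).
Proof.
  induction 1 as [A a|A a|A B _ tAB _ tA|A _ tA|A _ tA].
  - apply IKt_ipl, ipl_axiom_subst, a.
  - apply IKt_ax, IKt_axiom_subst, a.
  - exact (IKt_mp _ _ tAB tA).
  - exact (IKt_RH _ tA).
  - exact (IKt_RG _ tA).
Qed.

Lemma IKt_theory : ipl_theory IKt.
Proof. split; [exact IKt_ipl | exact IKt_mp]. Qed.

Lemma IKt_gc1 A B : IKt (A → H B) -> IKt (F A → B).
Proof.
  intros t. apply (@imp_trans _ IKt_theory _ (F (H B))).
  - exact (IKt_mp _ _ (IKt_ax _ (IKt5 _ _)) (IKt_RG _ t)).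
  - apply IKt_ax, IKt8.
Qed.

Lemma IKt_gc2 A B : IKt (F A → B) -> IKt (A → H B).
Proof.
  intros t. apply (@imp_trans _ IKt_theory _ (H (F A))).
  - apply IKt_ax, IKt9.
  - exact (IKt_mp _ _ (IKt_ax _ (IKt2' _ _)) (IKt_RH _ t)).
Qed.

Lemma IKt_gc3 A B : IKt (A → G B) -> IKt (P A → B).
Proof.
  intros t. apply (@imp_trans _ IKt_theory _ (P (G B))).
  - exact (IKt_mp _ _ (IKt_ax _ (IKt5' _ _)) (IKt_RH _ t)).
  - apply IKt_ax, IKt8'.
Qed.

Lemma IKt_gc4 A B : IKt (P A → B) -> IKt (A → G B).
Proof.
  intros t. apply (@imp_trans _ IKt_theory _ (G (P A))).
  - apply IKt_ax, IKt9'.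
  - exact (IKt_mp _ _ (IKt_ax _ (IKt2 _ _)) (IKt_RG _ t)).
Qed.

Lemma Int2GC_IKt A : Int2GC A -> IKt A.
Proof.
  pose proof (theory_IPL IKt_theory) as IPL_IKt.
  induction 1; eauto using IKt_subst, IKt_mp, IKt_gc1, IKt_gc2, IKt_gc3,
    IKt_gc4.
Qed.

Lemma FS_axiom_IKt A : FS_axiom A -> IKt A.
Proof. intros []; apply IKt_ax; constructor. Qed.

Lemma Int2GC_FS_IKt A : Int2GC_FS A -> IKt A.
Proof.
  induction 1; eauto using Int2GC_IKt, FS_axiom_IKt, IKt_subst, IKt_mp,
    IKt_gc1, IKt_gc2, IKt_gc3, IKt_gc4.
Qed.

(** * Time reversal *)

Fixpoint mirror (A : form) : form :=
  match A with
  | Var n => Var n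
  | ¬ A => ¬ mirror A
  | A ∨ B => mirror A ∨ mirror B
  | A ∧ B => mirror A ∧ mirror B
  | A → B => mirror A → mirror B
  | F A => P (mirror A)
  | G A => H (mirror A)
  | P A => F (mirror A)
  | H A => G (mirror A)
  end.

Lemma mirror_involutive A : mirror (mirror A) = A.
Proof. induction A; simpl; congruence. Qed.

(** Needed for the substitution rule: reversing an instance reverses the substituted formulas as
    well. *)
Lemma mirror_subst s A :
  mirror (subst s A) = subst (fun n => mirror (s n)) (mirror A).
Proof. induction A; simpl; congruence. Qed.

Lemma ipl_axiom_mirror A : ipl_axiom A -> ipl_axiom (mirror A).
Proof. intros []; constructor. Qed.

Lemma IPL_mirror A : IPL A -> IPL (mirror A).
Proof.
  induction 1 as [A a|A B _ tAB _ tA].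
  - apply IPL_ax, ipl_axiom_mirror, a.
  - exact (IPL_mp _ _ tAB tA).
Qed.

Lemma Int2GC_mirror A : Int2GC A -> Int2GC (mirror A).
Proof.
  induction 1; simpl in *;
    [ | rewrite mirror_subst | .. ];
    eauto using Int2GC, IPL_mirror.
Qed.

Lemma FS_axiom_mirror A : FS_axiom A -> FS_axiom (mirror A).
Proof. intros []; constructor. Qed.

Lemma Int2GC_FS_mirror A : Int2GC_FS A -> Int2GC_FS (mirror A).
Proof.
  induction 1; simpl in *;
    [ | | rewrite mirror_subst | .. ];
    eauto using Int2GC_FS, Int2GC_mirror, FS_axiom_mirror.
Qed.

(** Reduces each statement about [P] and [H] to its counterpart for [F] and [G]. *)
Lemma Int2GC_FS_of_mirror A : Int2GC_FS (mirror A) -> Int2GC_FS A.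
Proof. intros t%Int2GC_FS_mirror. now rewrite mirror_involutive in t. Qed.

(** * From [IKt] to [Int2GC_FS] *)

Lemma Int2GC_FS_theory : ipl_theory Int2GC_FS.
Proof.
  split; [ | exact FS_mp]. intros A a. apply FS_Int2GC, Int2GC_IPL, IPL_ax, a.
Qed.

Local Notation L := Int2GC_FS.
Local Notation thL := Int2GC_FS_theory.

Lemma FH_counit A : L (F (H A) → A).
Proof. apply FS_gc1, (imp_refl thL). Qed.

Lemma HF_unit A : L (A → H (F A)).
Proof. apply FS_gc2, (imp_refl thL). Qed.

Lemma PG_counit A : L (P (G A) → A).
Proof. apply FS_gc3, (imp_refl thL). Qed.

Lemma F_mono {A B} : L (A → B) -> L (F A → F B).
Proof. intros t. apply FS_gc1, (imp_trans thL t), HF_unit. Qed.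

Lemma G_mono {A B} : L (A → B) -> L (G A → G B).
Proof. intros t. apply FS_gc4. exact (imp_trans thL (PG_counit A) t). Qed.

(** A provable [A] follows from [P A] by weakening; transposing gives [A → G A]. *)
Lemma G_nec A : L A -> L (G A).
Proof.
  intros t. apply (FS_mp A); [ | exact t]. apply FS_gc4, (imp_const thL t).
Qed.

(** Transposed along [P] and [G], the two conjuncts of the goal become the projections of
    [G A ∧ G B]. *)
Lemma G_and A B : L (G A ∧ G B → G (A ∧ B)).
Proof.
  apply FS_gc4, (imp_and thL); apply FS_gc3, (theory_ax thL); constructor.
Qed.

Lemma G_and_iff A B : L (G (A ∧ B) ↔ G A ∧ G B).
Proof.
  apply (iff_intro thL); [ | apply G_and].
  apply (imp_and thL); apply G_mono, (theory_ax thL); constructor.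
Qed.

Lemma F_or_iff A B : L (F (A ∨ B) ↔ F A ∨ F B).
Proof.
  apply (iff_intro thL).
  - apply FS_gc1, (or_imp thL); apply FS_gc2, (theory_ax thL); constructor.
  - apply (or_imp thL); apply F_mono, (theory_ax thL); constructor.
Qed.

(** Meet preservation reduces this to the image under [G] of [(A → B) ∧ A → B]. *)
Lemma G_K A B : L (G (A → B) → G A → G B).
Proof.
  apply (imp_curry thL), (imp_trans thL (G_and _ _)), G_mono.
  apply (and_imp thL), (imp_refl thL).
Qed.

Lemma F_imp A B : L (F (A → B) → G A → F B).
Proof. apply FS_ax, FS1. Qed.

Lemma GF_K A B : L (G (A → B) → F A → F B).
Proof.
  apply (imp_flip thL). apply (@imp_trans _ thL _ (F ((A → B) → B))).
  - apply F_mono, (imp_flip thL), (imp_refl thL).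
  - apply F_imp.
Qed.

Lemma GF_and A B : L (G A ∧ F B → F (A ∧ B)).
Proof.
  apply (and_imp thL), (imp_flip thL).
  apply (@imp_trans _ thL _ (F (A → A ∧ B))).
  - apply F_mono, (imp_flip thL), (theory_ax thL), ipl_andI.
  - apply F_imp.
Qed.

Lemma neg_absurd A B : L (¬ A ∧ A → B).
Proof. apply (and_imp thL), (theory_ax thL), ipl_negE. Qed.

Lemma G_neg A : L (G (¬ A) → ¬ F A).
Proof.
  (* The language has no falsity constant, so absurdity means implying every [C]. By adjunction,
     [F (¬ A ∧ A) → C] reduces to [¬ A ∧ A → H C]. *)
  assert (absurd : forall C, L (G (¬ A) ∧ F A → C)).
  { intros C. apply (imp_trans thL (GF_and _ _)), FS_gc1, neg_absurd. }
  (* Negation introduction for [F A] under the hypothesis [G (¬ A)], with [F A] and [¬ F A] as the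
     contradictory pair. *)
  apply (@imp_app _ thL _ (F A → ¬ F A)).
  - apply (@imp_app _ thL _ (F A → F A)).
    + apply (imp_const thL), (theory_ax thL), ipl_negI.
    + apply (imp_const thL), (imp_refl thL).
  - apply (imp_curry thL), absurd.
Qed.

Lemma IKt_axiom_Int2GC_FS A : IKt_axiom A -> L A.
Proof.
  assert (FS3_L : forall A B, L ((F A → G B) → G (A → B))).
  { intros. apply FS_ax, FS3. }
  (* The first alternative settles the unprimed axioms, the second the primed ones after time
     reversal. *)
  intros []; solve
    [ auto using G_K, G_and_iff, F_or_iff, GF_K, GF_and, G_neg, FH_counit,
        HF_unit, F_imp
    | apply Int2GC_FS_of_mirror; simpl;
      auto using G_K, G_and_iff, F_or_iff, GF_K, GF_and, G_neg, FH_counit,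
        HF_unit, F_imp ].
Qed.

Lemma IKt_Int2GC_FS A : IKt A -> L A.
Proof.
  induction 1 as [A a|A a|A B _ tAB _ tA|A _ tA|A _ tA].
  - exact (theory_ax thL a).
  - exact (IKt_axiom_Int2GC_FS A a).
  - exact (FS_mp _ _ tAB tA).
  (* Rule (RH) is the mirror image of (RG): reverse [A], necessitate with [G], and reverse back. *)
  - apply Int2GC_FS_of_mirror, G_nec, Int2GC_FS_mirror, tA.
  - exact (G_nec A tA).
Qed.

Theorem theorem5p1 : forall A : form, IKt A <-> Int2GC_FS A.
Proof.
  intros A. split; [apply IKt_Int2GC_FS | apply Int2GC_FS_IKt].
Qed.
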